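(* Let $U,\hat U$ be Hilbert spaces, $Q:U\to\hat U$ a bounded linear operator, $w\in\hat U$, $u^{(0)}\in U$, and let $(u^{(n)})_{n\ge0}$ satisfy $$u^{(n+1)}=u^{(n)}-\alpha_n\,Q^*(Qu^{(n)}-w),\qquad n\ge0,$$ where $(\alpha_n)_{n\ge0}$ is a real sequence such that $\lambda_n:=\alpha_n\|Q\|^2/2$ satisfies $\lambda_n\in[0,1]$ for all $n\ge0$ and $\sum_{n\ge0}\lambda_n(1-\lambda_n)=\infty$. Then: (i) if $M_{Q,w}\ne\emptyset$, $u^{(n)}$ converges in norm to $P_{M_{Q,w}}u^{(0)}$; (ii) if $M_{Q,w}=\emptyset$, $\|u^{(n)}\|$ tends to $\infty$.
   Context: $Q^*$ is the adjoint of $Q$. $M_{Q,w}:=\{u\in U:\|Qu-w\|=\inf_{v\in U}\|Qv-w\|\}$ is the (closed affine, possibly empty) set of least-squares solutions, and $P_S$ denotes the orthogonal projection onto a nonempty closed affine subspace $S$. *)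

(* Defs.v *)
From HB Require Import structures.
From mathcomp Require Import all_boot all_order all_algebra sesquilinear.
From mathcomp Require Import all_classical all_reals all_analysis.
From mathcomp Require Import complex.

Set Implicit Arguments.
Unset Strict Implicit.
Unset Printing Implicit Defensive.

Import Order.TTheory GRing.Theory Num.Theory.
Import numFieldNormedType.Exports.

Local Open Scope classical_set_scope.
Local Open Scope ring_scope.

(* Hilbert spaces are taken over either the real or the complex numbers; the
   scalar field is [R] or [R[i]].  Norms in normed modules over [R[i]] take
   their values in [R[i]]; [scalar_re] brings them back to [R]. *)
Inductive scalar_kind := RealScalars | ComplexScalars.

Definition scalars (R : realType) (k : scalar_kind) : numFieldType :=
  match k with
  | RealScalars => R
  | ComplexScalars => R[i]
  end.

Definition scalar_conj (R : realType) (k : scalar_kind) :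
    {rmorphism scalars R k -> scalars R k} :=
  match k with
  | RealScalars => idfun
  | ComplexScalars => @conjc R
  end.

Definition scalar_re (R : realType) (k : scalar_kind) : scalars R k -> R :=
  match k with
  | RealScalars => fun x => x
  | ComplexScalars => @complex.Re R
  end.

Definition of_real (R : realType) (k : scalar_kind) : R -> scalars R k :=
  match k with
  | RealScalars => fun x => x
  | ComplexScalars => fun x => (x%:C)%C
  end.

(* The inner product is linear in its first argument and conjugate-linear in
   the second one. *)
HB.mixin Record CompleteNormedModule_isHilbert (R : realType) (k : scalar_kind)
    V & CompleteNormedModule (scalars R k) V := {
  inner : {dot V for scalar_conj R k};
  inner_norm : forall x : V, inner x x = `|x| ^+ 2
}.

#[short(type="hilbertType")]
HB.structure Definition Hilbert (R : realType) (k : scalar_kind) :=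
  {V of CompleteNormedModule (scalars R k) V
      & CompleteNormedModule_isHilbert R k V}.

Section Hilbert_defs.
Variables (R : realType) (k : scalar_kind).

Definition rnorm (V : hilbertType R k) (x : V) : R := scalar_re `|x|.

Variables U W : hilbertType R k.

Definition bounded_operator (Q : U -> W) : Prop :=
  exists M : R, forall x, rnorm (Q x) <= M * rnorm x.

Definition opnorm (Q : U -> W) : R :=
  sup [set rnorm (Q x) | x in [set x : U | rnorm x <= 1]].

(* [get] selects the element satisfying the predicate; for a bounded linear
   [Q] it exists (Riesz) and is unique. *)
Definition adjoint (Q : U -> W) (y : W) : U :=
  get [set z : U | forall x, inner (Q x) y = inner x z].

Definition least_squares (Q : U -> W) (w : W) : set U :=
  [set u | rnorm (Q u - w) = inf (range (fun v => rnorm (Q v - w)))].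

(* For a nonempty closed affine subspace [S], the point of [S] such that
   [x - p] is orthogonal to the direction of [S] exists and is unique. *)
Definition orth_proj (S : set U) (x : U) : U :=
  get [set p | S p /\ forall s, S s -> inner (x - p) (s - p) = 0].

End Hilbert_defs.

(* Main.v *)
(* Write A = Q^* Q and L = |Q|^2.  Since A is self-adjoint with
   |A x|^2 <= L <A x, x>, each step x |-> x - alpha_n A x satisfies
     |x - alpha_n A x|^2
       <= |x|^2 - (4 / L^2) lambda_n (1 - lambda_n) |A x|^2.
   The steps commute with A and are contractions, so |A x_n| is nonincreasing;
   summing the inequality and using the divergence of
   sum lambda_n (1 - lambda_n) gives A x_n -> 0, i.e. the products of the steps
   tend to 0 on the range of A.  Being contractions, they tend to 0 pointwise on
   the closure of that range, which is the orthogonal complement of ker A.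

   Least-squares solutions are the solutions of A x = Q^* w.  If p is the
   projection of u_0 on them, then u_n - p is the image of
   u_0 - p in (ker A)^perp.  In general the residuals A u_n - Q^* w tend to 0,
   because the initial one lies in (ker A)^perp; if |u_n| does not tend to
   infinity, there are approximate solutions of A x = Q^* w of bounded norm and
   arbitrarily small residual, and then an exact solution exists.  This last
   step, projections and the Riesz theorem all come from one fact: a
   decreasing sequence of closed convex sets that all meet a fixed ball has a
   common point of minimal norm.

   Only the real part of the inner product is used, so that real and complex
   scalars are treated together. *)

Require Import Defs.
From HB Require Import structures.
From mathcomp Require Import all_boot all_order all_algebra sesquilinear.
From mathcomp Require Import all_classical all_reals all_analysis.
From mathcomp Require Import complex ring lra.

Set Implicit Arguments.
Unset Strict Implicit.
Unset Printing Implicit Defensive.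

Import Order.TTheory GRing.Theory Num.Theory.
Import numFieldNormedType.Exports.
Local Open Scope classical_set_scope.
Local Open Scope ring_scope.

(** * Real and complex scalars under one interface *)

Section Scalars.
Variables (R : realType) (k : scalar_kind).
Local Notation re := (@scalar_re R k).
Local Notation ofr := (@of_real R k).

Lemma scalar_reD x y : re (x + y) = re x + re y.
Proof. by case: k x y => //= -[a b] [c d]. Qed.

Lemma scalar_reN x : re (- x) = - re x.
Proof. by case: k x => //= -[a b]. Qed.

Lemma scalar_reMl a x : re (ofr a * x) = a * re x.
Proof. by case: k x => //= -[b c] /=; rewrite mul0r subr0. Qed.

Lemma scalar_re_conj x : re (scalar_conj R k x) = re x.
Proof. by case: k x => //= -[b c]. Qed.

Lemma of_realK a : re (ofr a) = a.
Proof. by case: k. Qed.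

(** The choices [c = 1] and [c = i] recover the real and imaginary parts. This lifts identities
    proved for the real part of the inner product to [inner] itself. *)
Lemma scalar_re_inj_mul x y : (forall c, re (c * x) = re (c * y)) -> x = y.
Proof.
case: k x y => /= [x y /(_ 1)|[a b] [c d] h]; first by rewrite !mul1r.
have := h 1; rewrite !mul1r /= => ->.
have := h ('i)%C; rewrite /= !mul0r !mul1r !sub0r => /oppr_inj ->.
by [].
Qed.

(** In the order of [R[i]], a nonnegative element has zero imaginary part; norms are the main
    instance. *)
Lemma ge0_of_realK x : 0 <= x -> ofr (re x) = x.
Proof.
case: k x => //= -[a b]; rewrite lecE /= => /andP[/eqP ->] _; by [].
Qed.

Lemma ler_of_real a b : (ofr a <= ofr b) = (a <= b).
Proof. by case: k => //=; rewrite lecR. Qed.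

Lemma ltr_of_real a b : (ofr a < ofr b) = (a < b).
Proof. by case: k => //=; rewrite ltcR. Qed.

Lemma of_real0 : ofr (0 : R) = 0. Proof. by case: k. Qed.
Lemma of_real1 : ofr (1 : R) = 1. Proof. by case: k. Qed.

Lemma of_realD a b : ofr (a + b) = ofr a + ofr b.
Proof. by case: k => //=; rewrite rmorphD. Qed.

Lemma of_realN a : ofr (- a) = - ofr a.
Proof. by case: k => //=; rewrite rmorphN. Qed.

Lemma norm_of_real a : `|ofr a| = ofr `|a|.
Proof. by case: k => //=; rewrite normc_def /= expr0n /= addr0 sqrtr_sqr. Qed.
End Scalars.

(** * The real part of the inner product as a real inner product *)

Section RealInner.
Variables (R : realType) (k : scalar_kind) (V : hilbertType R k).
Implicit Types x y z : V.

Definition rinner x y : R := scalar_re (inner x y).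

Definition rscale (a : R) x : V := of_real k a *: x.

Lemma of_real_rnorm x : of_real k (rnorm x) = `|x|.
Proof. exact: ge0_of_realK. Qed.

Lemma rnorm_ge0 x : 0 <= rnorm x.
Proof. by rewrite -(ler_of_real k) of_real_rnorm of_real0. Qed.

Lemma rnorm0 : rnorm (0 : V) = 0.
Proof. by rewrite /rnorm normr0 -(of_real0 R k) of_realK. Qed.

Lemma rnorm_eq0 x : rnorm x = 0 -> x = 0.
Proof. by move=> h; apply/normr0_eq0; rewrite -of_real_rnorm h of_real0. Qed.

Lemma ler_rnormD x y : rnorm (x + y) <= rnorm x + rnorm y.
Proof.
by rewrite -(ler_of_real k) of_realD !of_real_rnorm ler_normD.
Qed.

Lemma rnormN x : rnorm (- x) = rnorm x.
Proof. by rewrite /rnorm normrN. Qed.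

Lemma rnormB x y : rnorm (x - y) = rnorm (y - x).
Proof. by rewrite /rnorm distrC. Qed.

Lemma rinnerxx x : rinner x x = rnorm x ^+ 2.
Proof.
by rewrite /rinner inner_norm -of_real_rnorm expr2 scalar_reMl of_realK.
Qed.

Lemma rinnerC x y : rinner x y = rinner y x.
Proof. by rewrite /rinner hermC expr0 mul1r scalar_re_conj. Qed.

Lemma rinnerDl x y z : rinner (x + y) z = rinner x z + rinner y z.
Proof. by rewrite /rinner linearDl scalar_reD. Qed.

Lemma rinnerNl x y : rinner (- x) y = - rinner x y.
Proof. by rewrite /rinner linearNl scalar_reN. Qed.

Lemma rinnerZl a x y : rinner (rscale a x) y = a * rinner x y.
Proof. by rewrite /rinner linearZl_LR scalar_reMl. Qed.

Lemma rinnerDr x y z : rinner x (y + z) = rinner x y + rinner x z.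
Proof. by rewrite rinnerC rinnerDl !(rinnerC x). Qed.

Lemma rinnerNr x y : rinner x (- y) = - rinner x y.
Proof. by rewrite rinnerC rinnerNl rinnerC. Qed.

Lemma rinnerZr a x y : rinner x (rscale a y) = a * rinner x y.
Proof. by rewrite rinnerC rinnerZl rinnerC. Qed.

Lemma rnormZ a x : rnorm (rscale a x) = `|a| * rnorm x.
Proof.
by rewrite /rnorm /rscale normrZ norm_of_real scalar_reMl.
Qed.

Definition rinnerE :=
  (rinnerDl, rinnerDr, rinnerNl, rinnerNr, rinnerZl, rinnerZr).

Lemma sqr_rnormD x y :
  rnorm (x + y) ^+ 2 = rnorm x ^+ 2 + 2 * rinner x y + rnorm y ^+ 2.
Proof. by rewrite -!rinnerxx !rinnerE (rinnerC y x); lra. Qed.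

(** Cauchy-Schwarz follows from the triangle inequality of the normed space: square it and expand
    the left side. *)
Lemma rinner_le x y : rinner x y <= rnorm x * rnorm y.
Proof.
have := ler_rnormD x y; have := rnorm_ge0 x; have := rnorm_ge0 y.
have := rnorm_ge0 (x + y); have := sqr_rnormD x y; nra.
Qed.

Lemma parallelogram x y :
  rnorm (x - y) ^+ 2 =
  2 * rnorm x ^+ 2 + 2 * rnorm y ^+ 2 - 4 * rnorm (rscale 2^-1 (x + y)) ^+ 2.
Proof. by rewrite -!rinnerxx !rinnerE (rinnerC y x); lra. Qed.
End RealInner.

(** First-order optimality condition: at [t = a / (b + 1)] the quadratic is negative unless [a = 0].
    The [+ 1] keeps the denominator positive when [b = 0]. *)
Lemma quadratic_ge0_linear_eq0 (R : realFieldType) (a b : R) :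
  0 <= b -> (forall t, 0 <= t ^+ 2 * b - 2 * t * a) -> a = 0.
Proof.
move=> b0 /(_ (a / (b + 1))) h.
apply/eqP; rewrite -sqrf_eq0 eq_le sqr_ge0 andbT.
have b1 : b + 1 != 0 by rewrite gt_eqF// ltr_wpDl.
have e : (a / (b + 1)) ^+ 2 * b - 2 * (a / (b + 1)) * a =
  - (a ^+ 2) * ((b + 2) / (b + 1) ^+ 2) by field.
by move: h; rewrite e mulNr oppr_ge0 pmulr_lle0 // divr_gt0// ?exprn_gt0//; lra.
Qed.

(** * Completeness, projections and the Riesz theorem *)

Section Geometry.
Variables (R : realType) (k : scalar_kind) (V : hilbertType R k).
Implicit Types (x y z : V) (S : set V).

Lemma rnorm_complete (x : nat -> V) :
  (forall e : R, 0 < e -> exists N, forall n m, (N <= n)%N -> (n <= m)%N ->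
     rnorm (x n - x m) < e) ->
  exists l, forall e : R, 0 < e -> exists N, forall n, (N <= n)%N ->
     rnorm (x n - l) < e.
Proof.
move=> h; have cx : cvg (x @ \oo).
  apply/cauchy_cvgP/cauchyP => e e0.
  have eE := ge0_of_realK (ltW e0).
  have /h[N hN] : 0 < scalar_re e.
    by rewrite -(ltr_of_real k) eE of_real0.
  exists (x N); exists N => // n /= Nn.
  rewrite -ball_normE /ball_ /= -of_real_rnorm -eE ltr_of_real.
  exact: hN.
exists (lim (x @ \oo)) => e e0.
move/cvgrPdist_lt : cx => /(_ (of_real k e)).
rewrite -(of_real0 R k) ltr_of_real => /(_ e0)[N _ hN].
exists N => n Nn; have := hN n Nn.
by rewrite /= -of_real_rnorm ltr_of_real rnormB.
Qed.

Definition rclosed S :=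
  forall x, (forall e : R, 0 < e -> exists2 c, S c & rnorm (c - x) < e) -> S x.

(** Closure under midpoints is the only form of convexity that the parallelogram law calls for. *)
Definition midconvex S :=
  forall x y, S x -> S y -> S (rscale 2^-1 (x + y)).

(* Almost-minimal elements of the [C n] form a Cauchy sequence, because by the
   parallelogram law two of them with distant positions would have a midpoint of
   too small a norm. *)
Lemma nested_convex_min (C : nat -> set V) (M : R) :
  (forall n m, (n <= m)%N -> C m `<=` C n) ->
  (forall n, midconvex (C n)) -> (forall n, rclosed (C n)) ->
  (forall n, exists2 x, C n x & rnorm x <= M) ->
  exists l, (forall n, C n l) /\
    forall y, (forall n, C n y) -> rnorm l <= rnorm y.
Proof.
move=> Cdec Cmid Ccl CM.
pose E n : set R := [set rnorm x ^+ 2 | x in C n].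
pose d n := inf (E n).
have El n : lbound (E n) 0 by move=> _ [x _ <-]; exact: sqr_ge0.
have Einf n : has_inf (E n).
  split; last by exists 0; exact: El.
  by have [x Cx _] := CM n; exists (rnorm x ^+ 2), x.
have dle n x : C n x -> d n <= rnorm x ^+ 2.
  move=> Cx; apply: ge_inf; first by exists 0; exact: El.
  by exists x.
have dM n : d n <= M ^+ 2.
  have [x Cx xM] := CM n; apply: le_trans (dle _ _ Cx) _.
  by rewrite lerXn2r ?nnegrE// ?rnorm_ge0// (le_trans (rnorm_ge0 x)).
have dmono n m : (n <= m)%N -> d n <= d m.
  move=> nm; apply: lb_le_inf; first exact: (Einf m).1.
  by move=> _ [x Cx <-]; apply: dle; exact: Cdec Cx.
have /choice[x xP] n : exists x, C n x /\ rnorm x ^+ 2 < d n + n.+1%:R^-1.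
  have n0 : 0 < n.+1%:R^-1 :> R by rewrite invr_gt0.
  have [_ [x Cx <-] xlt] := inf_adherent n0 (Einf n).
  by exists x.
(* The infima [d n] increase and stay below [M ^+ 2], so [D] is their limit. *)
pose D := sup (range d).
have hD : has_sup (range d).
  by split; [exists (d 0%N), 0%N | exists (M ^+ 2) => _ [n _ <-]].
have dD n : d n <= D by apply: ub_le_sup; [exact: hD.2 | exists n].
have [l lP] : exists l, forall e : R, 0 < e -> exists N, forall n, (N <= n)%N ->
    rnorm (x n - l) < e.
  apply: rnorm_complete => e e0.
  (* The midpoint of [x n] and [x m] lies in [C n], so the parallelogram law bounds their squared
     distance by [2 (d m - d n) + 2/(n+1) + 2/(m+1)]. Each of [d m - d n], [1/(n+1)] and [1/(m+1)]
     will be below [e^2/8]. *)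
  have e8 : 0 < e ^+ 2 / 8 by rewrite divr_gt0 ?exprn_gt0.
  have [_ [N1 _ <-] N1P] := sup_adherent e8 hD; rewrite -/D in N1P.
  have [N2 _ N2P] := near_infty_natSinv_lt (PosNum e8).
  have {}N2P i : (N2 <= i)%N -> i.+1%:R^-1 < e ^+ 2 / 8 := N2P i.
  exists (maxn N1 N2) => n m; rewrite geq_max => /andP[n1 n2] nm.
  have := parallelogram (x n) (x m).
  have [xn xnlt] := xP n; have [xm xmlt] := xP m.
  have := dle _ _ (Cmid _ _ _ xn (Cdec _ _ nm _ xm)).
  have := N2P _ n2; have := N2P _ (leq_trans n2 nm).
  have := dmono _ _ n1; have := dmono _ _ nm; have := dD m.
  move=> a1 a2 a3 a4 a5 a6 par.
  rewrite -(@ltr_pXn2r _ 2) ?nnegrE ?rnorm_ge0 ?(ltW e0)//.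
  rewrite par; move: (n.+1%:R^-1) (m.+1%:R^-1) a4 a5 xnlt xmlt => p q *; lra.
exists l; split=> [n|y Cy].
  apply: Ccl => e /lP[N NP]; exists (x (maxn n N)).
    by apply: Cdec (xP _).1; exact: leq_maxl.
  by apply: NP; exact: leq_maxr.
apply/ler_addgt0Pr => e e0.
have [N1 N1P] := lP (e / 2) ltac:(lra).
have e4 : 0 < e ^+ 2 / 4 by rewrite divr_gt0 ?exprn_gt0.
have [N2 _ N2P] := near_infty_natSinv_lt (PosNum e4).
pose n := maxn N1 N2.
have := N1P n (leq_maxl _ _).
(* The right side is at most [(rnorm y + e/2)^2]; the other [e/2] pays for the distance from [x n]
   to [l]. *)
have : rnorm (x n) ^+ 2 <= rnorm y ^+ 2 + e ^+ 2 / 4.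
  apply: ltW; apply: lt_trans (xP n).2 _.
  by apply: ler_ltD (dle _ _ (Cy n)) (N2P n (leq_maxr _ _)).
have -> : rnorm l = rnorm (x n - (x n - l)) by rewrite opprB addrC subrK.
have := ler_rnormD (x n) (- (x n - l)); rewrite rnormN.
have := rnorm_ge0 (x n); have := rnorm_ge0 y.
move=> y0 x0 h1 h2 h3.
suff : rnorm (x n) <= rnorm y + e / 2 by lra.
rewrite -(@ler_pXn2r _ 2) ?nnegrE//; last by lra.
by have := mulr_ge0 y0 (ltW e0); rewrite sqrrD; lra.
Qed.

(** Only real scalars are involved, so that kernels of real-linear functionals qualify. *)
Definition rsubspace S := S 0 /\ forall a x y, S x -> S y -> S (rscale a x + y).

(** With [l] the point of least norm in the coset [x - S], obtained from a constant sequence of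
    sets, the projection is [x - l]. Comparing [l] with [l - t s] for all real [t] gives
    orthogonality. *)
Lemma projection_exists S x : rsubspace S -> rclosed S ->
  exists2 p, S p & forall s, S s -> rinner (x - p) s = 0.
Proof.
move=> [S0 SD] Scl.
have [||||l [Sl lmin]] :=
  @nested_convex_min (fun=> [set y | S (x - y)]) (rnorm x).
- by move=> n m _ y.
- move=> _ y z /= Sy Sz.
  have -> : x - rscale 2^-1 (y + z) =
      rscale 2^-1 (x - y) + (rscale 2^-1 (x - z) + 0).
    have {1}-> : x = rscale 2^-1 x + rscale 2^-1 x.
      rewrite /rscale -scalerDl -of_realD -[LHS](scale1r) -(of_real1 R k).
      by congr (of_real k _ *: _); lra.
    by rewrite /rscale !scalerBr scalerDr addr0 opprD addrACA.
  by apply: (SD) => //; apply: SD.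
- move=> _ y /= h; apply: Scl => e /h[c Sc clt]; exists (x - c) => //.
  by rewrite opprB addrC addrA subrK rnormB.
- by move=> _; exists x => //=; rewrite subrr.
exists (x - l) => [|s Ss]; first exact: (Sl 0%N).
rewrite opprB addrC subrK.
apply: (@quadratic_ge0_linear_eq0 _ _ (rnorm s ^+ 2)); first exact: sqr_ge0.
move=> t; have := lmin (l + rscale (- t) s) _.
rewrite -(@ler_pXn2r _ 2) ?nnegrE ?rnorm_ge0// sqr_rnormD rinnerZr rnormZ.
rewrite exprMn real_normK ?num_real// => h.
suff : rnorm l ^+ 2 <= rnorm l ^+ 2 + 2 * (- t * rinner l s) +
    (- t) ^+ 2 * rnorm s ^+ 2 by lra.
apply: h => _ /=; rewrite opprD addrA addrC.
have -> : - rscale (- t) s = rscale t s.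
  by rewrite /rscale of_realN scaleNr opprK.
by apply: SD => //; exact: (Sl 0%N).
Qed.

(** If [f v] is nonzero, subtracting from [v] its projection on the kernel leaves [e] orthogonal to
    the kernel. A suitable multiple of [e] represents [f]. *)
Lemma real_riesz (f : V -> R) (M : R) :
  {morph f : x y / x + y} -> (forall a x, f (rscale a x) = a * f x) ->
  (forall x, `|f x| <= M * rnorm x) -> exists z, forall x, f x = rinner x z.
Proof.
move=> fD fZ fM.
have [f0|/existsNP[v fv]] := pselect (forall x, f x = 0).
  by exists (rscale 0 0) => x; rewrite rinnerZr mul0r f0.
have f00 : f 0 = 0 by apply: (@addrI _ (f 0)); rewrite -fD !addr0.
have fN x : f (- x) = - f x.
  by apply/eqP; rewrite -addr_eq0 -fD addNr f00.
have [||p fp ort] := @projection_exists [set x | f x = 0] v.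
- by split=> // a x y /= fx fy; rewrite fD fZ fx fy mulr0 addr0.
- move=> x h /=; apply/eqP; rewrite -normr_le0; apply/ler_addgt0Pr => e e0.
  rewrite add0r.
  have M1 : 0 < `|M| + 1 by rewrite ltr_wpDl.
  have [c fc clt] := h (e / (`|M| + 1)) (divr_gt0 e0 M1).
  have -> : `|f x| = `|f (c - x)| by rewrite fD fN fc sub0r normrN.
  apply: le_trans (fM _) _.
  apply: (@le_trans _ _ ((`|M| + 1) * rnorm (c - x))).
    by rewrite ler_wpM2r ?rnorm_ge0// (le_trans (ler_norm M))// lerDl.
  by rewrite mulrC -ler_pdivlMr// ltW.
pose e := v - p; have fe : f e = f v by rewrite fD fN fp subr0.
have fe0 : f e != 0 by rewrite fe; apply/eqP.
have e0 : rnorm e ^+ 2 != 0.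
  rewrite sqrf_eq0; apply: contra fe0 => /eqP/rnorm_eq0 ->.
  by rewrite f00.
exists (rscale (f e / rnorm e ^+ 2) e) => x; rewrite rinnerZr.
(* This combination lies in the kernel of [f]; its orthogonality to [e] determines [f x]. *)
have := ort (rscale (- (f x / f e)) e + x) _.
rewrite /= fD fZ mulNr divfK// addNr => /(_ erefl).
rewrite -/e rinnerDr rinnerZr rinnerxx (rinnerC e x) => /eqP.
by rewrite mulNr addrC subr_eq0 => /eqP ->; field; rewrite fe0 -sqrf_eq0.
Qed.
End Geometry.

(** * Gradient steps for a symmetric cocoercive operator *)

Section SymmetricOperator.
Variables (R : realType) (k : scalar_kind) (V : hilbertType R k).
Variables (A : V -> V) (L : R).
Hypothesis AD : {morph A : x y / x + y}.
Hypothesis AZ : forall a x, A (rscale a x) = rscale a (A x).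
Hypothesis Asym : forall x y, rinner (A x) y = rinner x (A y).
Hypothesis L_gt0 : 0 < L.
Hypothesis A_cocoercive : forall x, rnorm (A x) ^+ 2 <= L * rinner (A x) x.
Implicit Types (x y z : V) (a : R).

Let A0 : A 0 = 0.
Proof. by apply: (@addrI _ (A 0)); rewrite -AD !addr0. Qed.

Let AN x : A (- x) = - A x.
Proof. by apply/eqP; rewrite -addr_eq0 -AD addNr A0. Qed.

Let A_bounded x : rnorm (A x) <= L * rnorm x.
Proof.
have [h|h] := lerP (rnorm (A x)) 0.
  by apply: le_trans h _; rewrite mulr_ge0 ?rnorm_ge0 ?ltW.
rewrite -(@ler_pM2l _ (rnorm (A x)))//.
apply: le_trans (A_cocoercive x) _.
by rewrite mulrCA ler_pM2l// rinner_le.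
Qed.

(* The minimal-norm elements of the sets |A x - y| <= 1/n play the role of a
   weak limit of a bounded sequence of approximate solutions. *)
Lemma bounded_approx_solution (M : R) y :
  (forall e : R, 0 < e -> exists2 x, rnorm (A x - y) < e & rnorm x <= M) ->
  exists x, A x = y.
Proof.
move=> h.
have Acont x c : rnorm (A x - y) <= L * rnorm (c - x) + rnorm (A c - y).
  have -> : A x - y = A (x - c) + (A c - y) by rewrite AD AN addrA subrK.
  apply: le_trans (ler_rnormD _ _) _.
  by rewrite lerD2r rnormB A_bounded.
have [||||x [Cx _]] := @nested_convex_min _ _ _
    (fun n => [set x | rnorm (A x - y) <= n.+1%:R^-1]) M.
- move=> n m nm x /= /le_trans; apply.
  by rewrite lef_pV2 ?posrE// ler_nat.
- move=> n x z /= xn zn.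
  have -> : A (rscale 2^-1 (x + z)) - y = rscale 2^-1 ((A x - y) + (A z - y)).
    have {1}-> : y = rscale 2^-1 (y + y).
      rewrite /rscale scalerDr -scalerDl -of_realD -[LHS](scale1r).
      rewrite -(of_real1 R k).
      by congr (of_real k _ *: _); lra.
    by rewrite AZ AD /rscale -scalerBr opprD addrACA.
  rewrite rnormZ ger0_norm// ler_pdivrMl//.
  by apply: le_trans (ler_rnormD _ _) _; rewrite mulrDl mul1r lerD.
- move=> n x hx /=; apply/ler_addgt0Pr => e e0.
  have [c cn cx] := hx (e / L) (divr_gt0 e0 L_gt0).
  apply: le_trans (Acont x c) _; rewrite addrC lerD//.
  by rewrite mulrC -ler_pdivlMr// ltW.
- move=> n; have n0 : 0 < n.+1%:R^-1 :> R by rewrite invr_gt0.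
  by have [x /ltW xn xM] := h _ n0; exists x.
exists x; apply/eqP; rewrite -subr_eq0; apply/eqP/rnorm_eq0/le_anti.
rewrite rnorm_ge0 andbT; apply/ler_addgt0Pr => e e0.
have [N _ /(_ N (leqnn N)) Ne] := near_infty_natSinv_lt (PosNum e0).
by rewrite add0r (le_trans (Cx N))// ltW.
Qed.

(** Project [x] on the closure of the range of [A], getting [p]. By symmetry [x - p] is in the
    kernel, hence orthogonal to [x]; it is also orthogonal to [p], so it vanishes. *)
Lemma ker_orth_approx_range x : (forall z, A z = 0 -> rinner x z = 0) ->
  forall e : R, 0 < e -> exists v, rnorm (A v - x) < e.
Proof.
move=> xort.
have [||p pS port] := @projection_exists _ _ _
    [set y | forall e : R, 0 < e -> exists v, rnorm (A v - y) < e] x.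
- split=> [e e0|a y z yS zS e e0]; first by exists 0; rewrite A0 subrr rnorm0.
  have a1 : 0 < 2 * (`|a| + 1) by rewrite mulr_gt0// ltr_wpDl.
  have [v vy] := yS (e / (2 * (`|a| + 1))) (divr_gt0 e0 a1).
  have [w wz] := zS (e / 2) ltac:(lra).
  exists (rscale a v + w).
  have -> : A (rscale a v + w) - (rscale a y + z) =
      rscale a (A v - y) + (A w - z).
    by rewrite AD AZ /rscale scalerBr opprD addrACA.
  apply: le_lt_trans (ler_rnormD _ _) _; rewrite rnormZ.
  move: vy; rewrite ltr_pdivlMr// => vy.
  by have := rnorm_ge0 (A v - y); have := normr_ge0 a; lra.
- move=> y h e e0 /=.
  have [c /(_ (e / 2) ltac:(lra))[v vc] cy] := h (e / 2) ltac:(lra).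
  exists v; have -> : A v - y = (A v - c) + (c - y) by rewrite addrA subrK.
  by apply: le_lt_trans (ler_rnormD _ _) _; lra.
suff -> : x = p by [].
have Axp : A (x - p) = 0.
  (* Symmetry turns the squared norm of [A (x - p)] into the pairing of [x - p] with
     [A (A (x - p))], an element of the range. *)
  apply: rnorm_eq0; apply/eqP; rewrite -sqrf_eq0 -rinnerxx Asym; apply/eqP.
  by apply: port => e e0; exists (A (x - p)); rewrite subrr rnorm0.
apply/eqP; rewrite -subr_eq0; apply/eqP/rnorm_eq0/eqP.
rewrite -sqrf_eq0 -rinnerxx rinnerDr rinnerNr (port p)// subr0 rinnerC.
by rewrite xort.
Qed.

Definition gradient_step a x := x - rscale a (A x).

Fixpoint descent (alpha : nat -> R) n x :=
  if n is m.+1 then gradient_step (alpha m) (descent alpha m x) else x.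

(** Expanding the square and bounding the cross term by cocoercivity leaves the coefficient
    [2a/L - a^2], rewritten here in terms of [a L / 2]. *)
Lemma sqr_rnorm_gradient_step a x : 0 <= a ->
  rnorm (gradient_step a x) ^+ 2 <=
  rnorm x ^+ 2 - 4 / L ^+ 2 * (a * L / 2 * (1 - a * L / 2)) * rnorm (A x) ^+ 2.
Proof.
move=> a0; rewrite /gradient_step sqr_rnormD rinnerNr rinnerZr rnormN rnormZ.
rewrite exprMn real_normK ?num_real// rinnerC.
have -> : 4 / L ^+ 2 * (a * L / 2 * (1 - a * L / 2)) = 2 * a / L - a ^+ 2.
  by field; rewrite gt_eqF.
have := A_cocoercive x; rewrite mulrC -ler_pdivrMr// => h.
have := ler_wpM2l a0 h; lra.
Qed.

(** * Decay of products of gradient steps *)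

Section Descent.
Variable alpha : nat -> R.
Let lambda n := alpha n * L / 2.
Hypothesis lambda01 : forall n, 0 <= lambda n <= 1.

Let alpha_ge0 n : 0 <= alpha n.
Proof.
have /andP[] := lambda01 n.
by rewrite /lambda -mulrA pmulr_lge0// divr_gt0.
Qed.

Let weight_ge0 n : 0 <= lambda n * (1 - lambda n).
Proof. by have /andP[? ?] := lambda01 n; rewrite mulr_ge0// subr_ge0. Qed.

Lemma rnorm_gradient_step n x : rnorm (gradient_step (alpha n) x) <= rnorm x.
Proof.
rewrite -(@ler_pXn2r _ 2) ?nnegrE ?rnorm_ge0//.
apply: le_trans (sqr_rnorm_gradient_step _ (alpha_ge0 n)) _.
rewrite gerBl mulr_ge0 ?sqr_ge0//.
by apply: mulr_ge0 (weight_ge0 n); rewrite divr_ge0// exprn_ge0// ltW.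
Qed.

Lemma rnorm_descent n x : rnorm (descent alpha n x) <= rnorm x.
Proof.
elim: n => //= n IH; exact: le_trans (rnorm_gradient_step _ _) IH.
Qed.

Lemma descentD n x y :
  descent alpha n (x + y) = descent alpha n x + descent alpha n y.
Proof.
elim: n => //= n ->.
by rewrite /gradient_step AD /rscale scalerDr opprD addrACA.
Qed.

Lemma descentA n x : descent alpha n (A x) = A (descent alpha n x).
Proof. by elim: n => //= n ->; rewrite /gradient_step AD AN AZ. Qed.

(** The one-step inequalities telescope. Since the norms of [A] along the orbit do not increase, the
    last one can replace all earlier ones and factor out of the sum. *)
Lemma descent_energy n x :
  4 / L ^+ 2 * series (fun n => lambda n * (1 - lambda n)) n *
    rnorm (A (descent alpha n x)) ^+ 2 <=
  rnorm x ^+ 2 - rnorm (descent alpha n x) ^+ 2.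
Proof.
elim: n => [|n IH].
  by rewrite /series/= big_geq// mulr0 mul0r subrr.
rewrite /series/= big_nat_recr//=.
have c0 : 0 <= 4 / L ^+ 2 by rewrite divr_ge0// exprn_ge0// ltW.
have S0 : 0 <= series (fun n => lambda n * (1 - lambda n)) n.
  by apply: sumr_ge0 => i _; exact: weight_ge0.
(* [A] commutes with the step, which is a contraction. *)
have dec : rnorm (A (gradient_step (alpha n) (descent alpha n x))) ^+ 2 <=
    rnorm (A (descent alpha n x)) ^+ 2.
  rewrite ler_pXn2r ?nnegrE ?rnorm_ge0//.
  rewrite {1}/gradient_step AD AN AZ.
  exact: rnorm_gradient_step.
have step := sqr_rnorm_gradient_step (descent alpha n x) (alpha_ge0 n).
rewrite -/(lambda n) in step.
apply: le_trans (ler_wpM2l _ dec) _.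
  by rewrite mulr_ge0// addr_ge0.
rewrite mulrDr mulrDl; move: IH step; rewrite /series/=; lra.
Qed.

Hypothesis divergence :
  series (fun n => lambda n * (1 - lambda n)) @ \oo --> +oo.

Lemma descent_range_cvg0 x (e : R) : 0 < e ->
  exists N, forall n, (N <= n)%N -> rnorm (descent alpha n (A x)) < e.
Proof.
(* Once the partial sum reaches [B], a norm of at least [e] would force the energy bound to exceed
   [rnorm x ^+ 2]. *)
move=> e0; pose B := (rnorm x ^+ 2 + 1) / (4 / L ^+ 2 * e ^+ 2).
have := (@cvgryPge _ _ _ _ _).1 divergence B => -[N _ NB].
exists N => n /NB/= Bn; rewrite descentA ltNge; apply/negP => en.
have c0 : 0 < 4 / L ^+ 2 by rewrite divr_gt0// exprn_gt0.
have := descent_energy n x.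
have h1 : rnorm x ^+ 2 + 1 <=
    4 / L ^+ 2 * series (fun n => lambda n * (1 - lambda n)) n * e ^+ 2.
  by move: Bn; rewrite ler_pdivrMr ?mulr_gt0 ?exprn_gt0//; lra.
have h2 : e ^+ 2 <= rnorm (A (descent alpha n x)) ^+ 2.
  by rewrite ler_pXn2r ?nnegrE ?rnorm_ge0 ?(ltW e0).
have h3 : 0 <= 4 / L ^+ 2 * series (fun n => lambda n * (1 - lambda n)) n.
  rewrite mulr_ge0 ?(ltW c0)//.
  by apply: sumr_ge0 => i _; exact: weight_ge0.
have := ler_wpM2l h3 h2; have := sqr_ge0 (rnorm (descent alpha n x)); lra.
Qed.

(** Split [x] into a range element [A v], whose orbit tends to 0, and an error below [e/2], which
    contractions do not enlarge. *)
Lemma descent_cvg0 x (e : R) : (forall z, A z = 0 -> rinner x z = 0) ->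
  0 < e -> exists N, forall n, (N <= n)%N -> rnorm (descent alpha n x) < e.
Proof.
move=> xort e0.
have [v vx] := ker_orth_approx_range xort (e := e / 2) ltac:(lra).
have [N NP] := descent_range_cvg0 v (e := e / 2) ltac:(lra).
exists N => n /NP nv.
have -> : x = (x - A v) + A v by rewrite subrK.
rewrite descentD; apply: le_lt_trans (ler_rnormD _ _) _.
by have := rnorm_descent n (x - A v); rewrite rnormB in vx; lra.
Qed.
End Descent.
End SymmetricOperator.

(** * Adjoint, normal equations and projection on the least-squares solutions *)

Section LeastSquares.
Variables (R : realType) (k : scalar_kind) (U W : hilbertType R k).
Variable Q : {linear U -> W}.
Hypothesis Qbd : bounded_operator Q.
Implicit Types (x z : U) (y w : W).

Let QZ a x : Q (rscale a x) = rscale a (Q x).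
Proof. by rewrite /rscale linearZ. Qed.

Lemma opnorm_ub x : rnorm x <= 1 -> rnorm (Q x) <= opnorm Q.
Proof.
move=> x1; apply: ub_le_sup; last by exists x.
have [M QM] := Qbd; exists `|M| => _ [t t1 <-]; apply: le_trans (QM t) _.
apply: (@le_trans _ _ (`|M| * rnorm t)).
  by rewrite ler_wpM2r ?rnorm_ge0// ler_norm.
by rewrite ler_piMr.
Qed.

Lemma opnorm_ge0 : 0 <= opnorm Q.
Proof.
by apply: le_trans (opnorm_ub (x := 0) _); rewrite ?rnorm0 ?rnorm_ge0.
Qed.

Lemma rnorm_le_opnorm x : rnorm (Q x) <= opnorm Q * rnorm x.
Proof.
have [x0|x0] := lerP (rnorm x) 0.
  have -> : x = 0 by apply/rnorm_eq0/le_anti; rewrite x0 rnorm_ge0.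
  by rewrite linear0 !rnorm0 mulr0.
have := opnorm_ub (x := rscale (rnorm x)^-1 x).
rewrite QZ !rnormZ ger0_norm ?invr_ge0 ?rnorm_ge0//.
by rewrite mulVf ?gt_eqF// => /(_ (lexx _)); rewrite mulrC ler_pdivrMr.
Qed.

(** Existence is all that [get] requires. Riesz applied to the real part gives a candidate, and
    replacing the argument by its scalar multiples yields the full identity. *)
Lemma adjointP x y : inner (Q x) y = inner x (adjoint Q y).
Proof.
suff [z zP] : exists z, forall x, inner (Q x) y = inner x z.
  apply: (getPex (P := [set z | forall x, inner (Q x) y = inner x z])).
  by exists z.
have [|||z zP] :=
  @real_riesz _ _ _ (fun x => rinner (Q x) y) (opnorm Q * rnorm y).
- by move=> x1 x2; rewrite linearD rinnerDl.
- by move=> a x1; rewrite QZ rinnerZl.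
- move=> x1.
  have h t : rinner (Q t) y <= opnorm Q * rnorm y * rnorm t.
    apply: le_trans (rinner_le _ _) _.
    by rewrite mulrAC ler_wpM2r ?rnorm_ge0// rnorm_le_opnorm.
  rewrite ler_norml h andbT lerNl -rinnerNl -linearN.
  by have := h (- x1); rewrite rnormN.
exists z => t; apply: scalar_re_inj_mul => c.
rewrite -!linearZl_LR -linearZ; exact: zP.
Qed.

Lemma rinner_adjoint x y : rinner (Q x) y = rinner x (adjoint Q y).
Proof. by rewrite /rinner adjointP. Qed.

Lemma rinner_ext x z : (forall t, rinner t x = rinner t z) -> x = z.
Proof.
move=> h; apply/eqP; rewrite -subr_eq0; apply/eqP/rnorm_eq0/eqP.
by rewrite -sqrf_eq0 -rinnerxx rinnerDr rinnerNr h subrr.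
Qed.

Lemma adjointD y1 y2 : adjoint Q (y1 + y2) = adjoint Q y1 + adjoint Q y2.
Proof.
by apply: rinner_ext => t; rewrite rinnerDr -!rinner_adjoint rinnerDr.
Qed.

Lemma adjointN y : adjoint Q (- y) = - adjoint Q y.
Proof.
by apply: rinner_ext => t; rewrite rinnerNr -!rinner_adjoint rinnerNr.
Qed.

Lemma adjointZ a y : adjoint Q (rscale a y) = rscale a (adjoint Q y).
Proof.
by apply: rinner_ext => t; rewrite rinnerZr -!rinner_adjoint rinnerZr.
Qed.

Definition gram x := adjoint Q (Q x).

Lemma gramD : {morph gram : x z / x + z}.
Proof. by move=> x z; rewrite /gram linearD adjointD. Qed.

Lemma gramN x : gram (- x) = - gram x.
Proof. by rewrite /gram linearN adjointN. Qed.

Lemma gramZ a x : gram (rscale a x) = rscale a (gram x).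
Proof. by rewrite /gram QZ adjointZ. Qed.

Lemma rinner_gram x z : rinner x (gram z) = rinner (Q x) (Q z).
Proof. by rewrite -rinner_adjoint. Qed.

Lemma gram_sym x z : rinner (gram x) z = rinner x (gram z).
Proof. by rewrite rinnerC !rinner_gram rinnerC. Qed.

(** After taking roots, the claim is that [gram x] has norm at most [opnorm Q * rnorm (Q x)]. This
    comes from pairing [gram x] with itself, moving the adjoint across, and cancelling one factor
    [rnorm (gram x)]. *)
Lemma gram_cocoercive x :
  rnorm (gram x) ^+ 2 <= opnorm Q ^+ 2 * rinner (gram x) x.
Proof.
rewrite gram_sym rinner_gram rinnerxx -exprMn.
rewrite ler_pXn2r ?nnegrE ?mulr_ge0 ?rnorm_ge0 ?opnorm_ge0//.
have [h|h] := lerP (rnorm (gram x)) 0.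
  by apply: le_trans h _; rewrite mulr_ge0 ?rnorm_ge0 ?opnorm_ge0.
rewrite -(@ler_pM2l _ (rnorm (gram x)))// -expr2 -rinnerxx rinner_gram.
apply: le_trans (rinner_le _ _) _.
by rewrite mulrA ler_wpM2r ?rnorm_ge0// mulrC rnorm_le_opnorm.
Qed.

Lemma gram_eq0 x : gram x = 0 -> Q x = 0.
Proof.
move=> h; apply: rnorm_eq0; apply/eqP; rewrite -sqrf_eq0 -rinnerxx.
(* Writing 0 as [0 - 0] shows that the pairing with 0 vanishes. *)
by rewrite -rinner_gram h -(subrr 0) rinnerDr rinnerNr subrr.
Qed.

(** These are the normal equations: expanding the residual at [v] around [x], the cross term pairs
    [v - x] with [gram x - adjoint Q w]. *)
Lemma least_squaresP w x : least_squares Q w x <-> gram x = adjoint Q w.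
Proof.
have lb : has_inf (range (fun v => rnorm (Q v - w))).
  split; first by exists (rnorm (Q 0 - w)), 0.
  by exists 0 => _ [v _ <-]; exact: rnorm_ge0.
have Qx v : Q v - w = (Q x - w) + Q (v - x).
  by rewrite linearB [RHS]addrC addrA subrK.
have cross v : rinner (Q x - w) (Q (v - x)) =
    rinner (v - x) (gram x - adjoint Q w).
  by rewrite rinnerC rinner_adjoint adjointD adjointN.
split=> [minx|eqx].
  apply/eqP; rewrite -subr_eq0; apply/eqP.
  set r := gram x - adjoint Q w.
  apply/rnorm_eq0/eqP; rewrite -sqrf_eq0; apply/eqP.
  apply: (@quadratic_ge0_linear_eq0 _ _ (rnorm (Q r) ^+ 2)).
    exact: sqr_ge0.
  (* Moving along [r] changes the squared residual by [t^2 |Q r|^2 - 2 t |r|^2], so minimality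
     forces [r = 0]. *)
  move=> t; pose v := x - rscale t r.
  have : rnorm (Q x - w) <= rnorm (Q v - w).
    by rewrite minx; apply: ge_inf; [exact: lb.2 | exists v].
  rewrite -(@ler_pXn2r _ 2) ?nnegrE ?rnorm_ge0// (Qx v).
  rewrite (sqr_rnormD _ (Q _)) cross -/r.
  have -> : v - x = - rscale t r by rewrite /v addrAC subrr add0r.
  rewrite rinnerNl rinnerZl linearN rnormN QZ rnormZ exprMn.
  rewrite real_normK ?num_real// rinnerxx; lra.
apply/le_anti/andP; split; last by apply: ge_inf; [exact: lb.2 | exists x].
apply: lb_le_inf; first exact: lb.1.
move=> _ [v _ <-]; rewrite -(@ler_pXn2r _ 2) ?nnegrE ?rnorm_ge0// (Qx v).
rewrite (sqr_rnormD _ (Q _)) cross eqx subrr -(subrr 0) rinnerDr.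
by rewrite rinnerNr subrr mulr0 addr0 lerDl sqr_ge0.
Qed.

(** For any solution [m], the solution set is [m] plus the kernel of [Q], so the projection is [m]
    plus that of [x - m] on the kernel. Orthogonality to the kernel of [gram] is the form used by
    [descent_cvg0]. *)
Lemma orth_projP w x : least_squares Q w !=set0 ->
  let p := orth_proj (least_squares Q w) x in
  least_squares Q w p /\ forall z, gram z = 0 -> rinner (x - p) z = 0.
Proof.
move=> [m /least_squaresP mw]; set S := least_squares Q w => p.
suff [q qP] : exists q, S q /\ forall s, S s -> inner (x - q) (s - q) = 0.
  have [Sp ort] : S p /\ forall s, S s -> inner (x - p) (s - p) = 0.
    apply: (getPex (P := [set p | S p /\
      forall s, S s -> inner (x - p) (s - p) = 0])).
    by exists q.
  split=> // z z0; have /ort : S (p + z).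
    by apply/least_squaresP; rewrite gramD z0 addr0; exact/least_squaresP.
  by rewrite addrAC subrr add0r /rinner => ->; rewrite -(of_real0 R k) of_realK.
have [||q q0 ort] := @projection_exists _ _ _ [set z | Q z = 0] (x - m).
- split=> [|a s t /= s0 t0]; first exact: linear0.
  by rewrite linearD QZ s0 t0 /rscale scaler0 addr0.
- move=> z h /=; apply/rnorm_eq0/le_anti; rewrite rnorm_ge0 andbT.
  apply/ler_addgt0Pr => e e0; rewrite add0r.
  have N1 : 0 < opnorm Q + 1 by rewrite ltr_wpDl ?opnorm_ge0.
  have [c /= c0 cz] := h (e / (opnorm Q + 1)) (divr_gt0 e0 N1).
  have -> : rnorm (Q z) = rnorm (Q (c - z)) by rewrite linearB c0 sub0r rnormN.
  apply: le_trans (rnorm_le_opnorm _) _.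
  move: cz; rewrite ltr_pdivlMr// => cz.
  by have := rnorm_ge0 (c - z); lra.
exists (m + q); split.
  apply/least_squaresP; rewrite gramD mw [gram q]/gram q0.
  by rewrite -(subrr (0 : W)) adjointD adjointN subrr addr0.
(* Swapping the arguments puts the kernel vector in the linear slot. The kernel of [Q] is stable
   under all scalars [c], so real orthogonality gives full orthogonality. *)
move=> s /least_squaresP sw; rewrite hermC expr0 mul1r.
rewrite -[RHS](rmorph0 (scalar_conj R k)); congr (scalar_conj R k _).
apply: scalar_re_inj_mul => c; rewrite -linearZl_LR mulr0 -[RHS]/(scalar_re 0).
rewrite -(of_real0 R k) of_realK -[LHS]/(rinner _ _) rinnerC.
rewrite opprD !addrA ort//=.
suff sm : Q (s - m - q) = 0 by rewrite linearZ /= sm scaler0.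
rewrite linearB q0 subr0.
by apply: gram_eq0; rewrite gramD gramN sw mw subrr.
Qed.
End LeastSquares.

(** * The convergence dichotomy *)

Unset Implicit Arguments.
Set Strict Implicit.

Theorem theorem4p1 (R : realType) (k : scalar_kind) (U W : hilbertType R k)
    (Q : {linear U -> W}) (w : W) (u : nat -> U) (alpha : nat -> R) :
  bounded_operator Q ->
  (forall n, u n.+1 = u n - of_real k (alpha n) *: adjoint Q (Q (u n) - w)) ->
  let lambda := fun n => alpha n * opnorm Q ^+ 2 / 2 in
  (forall n, 0 <= lambda n <= 1) ->
  series (fun n => lambda n * (1 - lambda n)) @ \oo --> +oo ->
  (least_squares Q w !=set0 ->
     u n @[n --> \oo] --> orth_proj (least_squares Q w) (u 0%N)) /\
  (least_squares Q w = set0 -> rnorm (u n) @[n --> \oo] --> +oo).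
Proof.
move=> Qbd uS lambda l01 div.
(* If [opnorm Q] were 0, every [lambda n] would vanish and the series could not diverge. *)
have L0 : 0 < opnorm Q ^+ 2.
  rewrite lt_neqAle sqr_ge0 andbT eq_sym; apply/eqP => L0.
  have := (@cvgryPge _ _ _ _ _).1 div 1 => -[N _ /(_ N (leqnn N))] /=.
  rewrite /series /= big1 ?ler10// => i _.
  by rewrite /lambda L0 mulr0 mul0r mul0r.
pose b := adjoint Q w.
have uS' n : u n.+1 = u n - rscale (alpha n) (gram Q (u n) - b).
  by rewrite uS adjointD// adjointN.
have cvg0 x e := @descent_cvg0 _ _ _ _ _ (gramD Qbd) (gramZ Qbd)
  (gram_sym Qbd) L0 (gram_cocoercive Qbd) _ l01 div x e.
split=> [Mn0|M0].
  have [/(least_squaresP Qbd) pM ort] := orth_projP Qbd (u 0%N) Mn0.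
  set p := orth_proj _ _ in pM ort *.
  (* Since [gram Q p = b], the errors follow the homogeneous recursion. *)
  have uE n : u n - p = descent (gram Q) alpha n (u 0%N - p).
    elim: n => //= n <-.
    by rewrite uS' /gradient_step gramD// gramN// pM addrAC.
  apply/cvgrPdist_lt => e e0; have eE := ge0_of_realK (ltW e0).
  have e1 : 0 < scalar_re e by rewrite -(ltr_of_real k) eE of_real0.
  have [N NP] := cvg0 _ _ ort e1.
  exists N => // n /= /NP.
  by rewrite -uE -(ltr_of_real k) of_real_rnorm eE distrC.
pose r n := gram Q (u n) - b.
(* Residuals follow the same homogeneous recursion, with no solution at hand. *)
have rE n : r n = descent (gram Q) alpha n (r 0%N).
  elim: n => //= n <-; rewrite /r uS' /gradient_step gramD// gramN// gramZ//.
  by rewrite addrAC gramD// gramN.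
have rort z : gram Q z = 0 -> rinner (r 0%N) z = 0.
  move=> /(gram_eq0 Qbd) z0.
  rewrite /r /b /gram -adjointN// -adjointD// rinnerC -rinner_adjoint// z0.
  by rewrite -(subrr 0) rinnerDl rinnerNl subrr.
apply/cvgryPge => B; apply: contrapT => nB.
have [x /(least_squaresP Qbd) xM] : exists x, gram Q x = b.
  apply: (@bounded_approx_solution _ _ _ _ _ (gramD Qbd) (gramZ Qbd)
    L0 (gram_cocoercive Qbd) B) => e e0.
  have [N NP] := cvg0 _ _ rort e0.
  (* By the choice of [B], some iterate beyond [N] has norm below [B]; its residual is already below
     [e]. *)
  apply: contrapT => h; apply: nB; exists N => // n /= Nn.
  rewrite leNgt; apply/negP => uB; apply: h; exists (u n); last exact: ltW.
  by rewrite -/(r n) rE; exact: NP.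
by move: xM; rewrite M0.
Qed.
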